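(* Let $p$ be an arbitrary prime, $n$ a positive integer, and let $F(X)=\sum_{0<i<j<n}c_{ij}X^{p^i+p^j+1}$ be a cubic function in $\mathbb{F}_{p^n}[X]$ (so $c_{ij}\in\mathbb{F}_{p^n}$). Then for any $a,b\in\mathbb{F}_{p^n}$, $$\nabla_F(a,b)=\begin{cases} p^n & \text{if } ab=0,\\ p^{\dim(\ker L_{a,b})} & \text{if } \delta_{a,b}\in\operatorname{Im}(L_{a,b}),\\ 0 & \text{if } \delta_{a,b}\notin\operatorname{Im}(L_{a,b}), \end{cases}$$ where $$L_{a,b}(X)=\sum_{0<i<j<n}c_{ij}\left(X\left(a^{p^i}b^{p^j}+a^{p^j}b^{p^i}\right)+X^{p^i}\left(ba^{p^j}+ab^{p^j}\right)+X^{p^j}\left(ba^{p^i}+ab^{p^i}\right)\right)$$ and $$\delta_{a,b}=\sum_{0<i<j<n}c_{ij}\left((a+b)\left(a^{p^i}b^{p^j}+a^{p^j}b^{p^i}\right)+ab^{p^i+p^j}+ba^{p^i+p^j}\right).$$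
   Context: For $F:\mathbb{F}_{p^n}\to\mathbb{F}_{p^n}$ and $a,b\in\mathbb{F}_{p^n}$, $\nabla_F(a,b)=\#\{X\in\mathbb{F}_{p^n}: F(X+a+b)-F(X+b)-F(X+a)+F(X)=0\}$. For the linearized polynomial $L_{a,b}$, $\ker L_{a,b}$ and $\operatorname{Im}(L_{a,b})$ denote the kernel and image of the $\mathbb{F}_p$-linear map $\mathbb{F}_{p^n}\to\mathbb{F}_{p^n}$ it induces, and $\dim$ is the dimension over $\mathbb{F}_p$. *)

(* Defs.v *)
From HB Require Import structures.
From mathcomp Require Import all_boot all_order all_algebra all_field.

Set Implicit Arguments.
Unset Strict Implicit.
Unset Printing Implicit Defensive.

Import GRing.Theory.
Local Open Scope ring_scope.

Definition nabla (F : finFieldType) (f : F -> F) (a b : F) : nat :=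
  #|[set x : F | f (x + a + b) - f (x + b) - f (x + a) + f x == 0]|.

(* Only the coefficients c i j with 0 < i < j are used. *)
Definition cubic_poly (F : finFieldType) (p n : nat) (c : 'I_n -> 'I_n -> F) :
    {poly F} :=
  \sum_(i < n) \sum_(j < n | (0 < i < j)%N) c i j *: 'X^(p ^ i + p ^ j + 1).

Definition L_poly (F : finFieldType) (p n : nat) (c : 'I_n -> 'I_n -> F)
    (a b : F) : {poly F} :=
  \sum_(i < n) \sum_(j < n | (0 < i < j)%N) c i j *:
    ((a ^+ (p ^ i) * b ^+ (p ^ j) + a ^+ (p ^ j) * b ^+ (p ^ i)) *: 'X
     + (b * a ^+ (p ^ j) + a * b ^+ (p ^ j)) *: 'X^(p ^ i)
     + (b * a ^+ (p ^ i) + a * b ^+ (p ^ i)) *: 'X^(p ^ j)).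

Definition delta (F : finFieldType) (p n : nat) (c : 'I_n -> 'I_n -> F)
    (a b : F) : F :=
  \sum_(i < n) \sum_(j < n | (0 < i < j)%N) c i j *
    ((a + b) * (a ^+ (p ^ i) * b ^+ (p ^ j) + a ^+ (p ^ j) * b ^+ (p ^ i))
     + a * b ^+ (p ^ i + p ^ j) + b * a ^+ (p ^ i + p ^ j)).

(* pPrimeCharType charF is F itself, seen as a vector space over its prime
   field 'F_p. *)
Definition L_fun (F : finFieldType) (p : nat) (charF : p \in [pchar F])
    (n : nat) (c : 'I_n -> 'I_n -> F) (a b : F) :
    pPrimeCharType charF -> pPrimeCharType charF :=
  fun x => (L_poly p c a b).[x : F].
Arguments L_fun {F p} charF {n} c a b x.

Lemma L_fun_is_zmod_morphism (F : finFieldType) (p : nat)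
    (charF : p \in [pchar F]) (n : nat) (c : 'I_n -> 'I_n -> F) (a b : F) :
  zmod_morphism (L_fun charF c a b).
Proof.
have frobB (k : nat) (x y : F) :
    (x - y) ^+ (p ^ k) = x ^+ (p ^ k) - y ^+ (p ^ k).
  elim: k => [|k IHk]; first by rewrite !expr1.
  by rewrite expnSr !exprM IHk -!(pFrobenius_autE charF) rmorphB.
move=> x y; rewrite /L_fun /L_poly !horner_sum -sumrB.
apply: eq_bigr => i _; rewrite !horner_sum -sumrB.
apply: eq_bigr => j _; rewrite !(hornerE, hornerXn) /= !frobB.
rewrite -[RHS]mulrBr; congr (_ * _).
by rewrite !mulrBr !opprD !addrA [RHS](ACl (1*4*2*5*3*6)%AC).
Qed.

HB.instance Definition _ (F : finFieldType) (p : nat)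
    (charF : p \in [pchar F]) (n : nat) (c : 'I_n -> 'I_n -> F) (a b : F) :=
  GRing.isZmodMorphism.Build _ _ (L_fun charF c a b)
    (@L_fun_is_zmod_morphism F p charF n c a b).

Lemma L_fun_is_scalable (F : finFieldType) (p : nat)
    (charF : p \in [pchar F]) (n : nat) (c : 'I_n -> 'I_n -> F) (a b : F) :
  scalable (L_fun charF c a b).
Proof.
by move=> k x; rewrite -[k]natr_Zp !scaler_nat raddfMn.
Qed.

HB.instance Definition _ (F : finFieldType) (p : nat)
    (charF : p \in [pchar F]) (n : nat) (c : 'I_n -> 'I_n -> F) (a b : F) :=
  GRing.isScalable.Build _ _ _ _ (L_fun charF c a b)
    (@L_fun_is_scalable F p charF n c a b).

Definition L_map (F : finFieldType) (p : nat) (charF : p \in [pchar F])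
    (n : nat) (c : 'I_n -> 'I_n -> F) (a b : F) :
    'End(pPrimeCharType charF) :=
  linfun (L_fun charF c a b).
Arguments L_map {F p} charF {n} c a b.

(* linfun returns a junk value on a map that is not linear. *)
Lemma L_mapE (F : finFieldType) (p : nat) (charF : p \in [pchar F])
    (n : nat) (c : 'I_n -> 'I_n -> F) (a b x : F) :
  L_map charF c a b x = (L_poly p c a b).[x].
Proof. exact: (lfunE (L_fun charF c a b)). Qed.

(* Main.v *)
(* Each monomial X^(p^i + p^j + 1) is a product of three additive maps, so the
   second difference of F in directions a, b is affine in X, equal to
   L_{a,b}(X) + delta_{a,b}. Its zero set is therefore empty or a coset of
   ker L_{a,b}. *)
Require Import Defs.
From mathcomp Require Import all_boot all_order all_algebra all_field.
From mathcomp Require Import ring.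

Set Implicit Arguments.
Unset Strict Implicit.
Unset Printing Implicit Defensive.

Import GRing.Theory.
Local Open Scope ring_scope.

Lemma exprDn_pchar_pow (R : comNzRingType) (p : nat) (charR : p \in [pchar R])
    (k : nat) (x y : R) :
  (x + y) ^+ (p ^ k) = x ^+ (p ^ k) + y ^+ (p ^ k).
Proof. by rewrite exprDn_pchar // pnatX pnatE ?(pcharf_prime charR) ?charR. Qed.

Lemma second_difference_cubic (F : finFieldType) (p : nat)
    (charF : p \in [pchar F]) (n : nat) (c : 'I_n -> 'I_n -> F) (a b x : F) :
  let f := fun y : F => (cubic_poly p c).[y] in
  f (x + a + b) - f (x + b) - f (x + a) + f x =
    (L_poly p c a b).[x] + delta p c a b.
Proof.
rewrite /= /cubic_poly /L_poly /delta !horner_sum -!sumrB -!big_split /=.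
apply: eq_bigr => i _; rewrite !horner_sum -!sumrB -!big_split /=.
apply: eq_bigr => j _; rewrite !(hornerE, hornerXn) /=.
(* Once exponents are split and Frobenius powers distributed over sums, the powers of [x], [a] and
   [b] act as independent atoms, and each [(i, j)] term is a plain commutative ring identity. *)
rewrite !exprD !(exprDn_pchar_pow charF) !expr1.
by ring.
Qed.

(** A subspace of dimension d over ['F_p] has p^d elements; this converts a count of roots into a
    kernel dimension. *)
Lemma card_lker_pPrimeChar (F : finFieldType) (p : nat)
    (charF : p \in [pchar F]) (f : 'End(pPrimeCharType charF)) :
  #|[set x : F | f x == 0]| = (p ^ \dim (lker f))%N.
Proof.
have := @card_vspace 'F_p F _ (lker f); rewrite card_Fp ?(pcharf_prime charF) // => <-.
by apply: eq_card => x; rewrite inE; exact/esym/memv_ker.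
Qed.

Theorem theorem4p3 (p n : nat) (p_pr : prime p) (n_gt0 : (0 < n)%N)
    (F : finFieldType) (cardF : #|F| = (p ^ n)%N)
    (c : 'I_n -> 'I_n -> F) (a b : F) :
  let charF := card_finPcharP cardF p_pr in
  let f := fun x : F => (cubic_poly p c).[x] in
  let L := L_map charF c a b in
  [/\ a * b = 0 -> nabla f a b = (p ^ n)%N,
      delta p c a b \in limg L -> nabla f a b = (p ^ \dim (lker L))%N
    & delta p c a b \notin limg L -> nabla f a b = 0%N].
Proof.
move=> charF f L.
have D2 x : f (x + a + b) - f (x + b) - f (x + a) + f x = L x + delta p c a b.
  by rewrite L_mapE; apply: (second_difference_cubic charF).
split.
- move=> /eqP; rewrite mulf_eq0 -cardF -cardsT /nabla => ab0.
  apply: eq_card => x; rewrite !inE; apply/eqP.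
  by case/orP: ab0 => /eqP ->; rewrite !addr0; ring.
- case/memv_imgP=> y _ Ly; rewrite -card_lker_pPrimeChar /nabla.
  (* With [delta] equal to [L y], the zero set is the preimage of the kernel under the translation
     by [y], a bijection of [F]. *)
  rewrite -[RHS](card_preimset _ (addIr (y : F))).
  apply: eq_card => x; rewrite !inE D2 Ly; congr (_ == _).
  by rewrite -linearD.
(* By contraposition: a root [x] gives [delta] = [- L x] = [L (- x)], so [delta] lies in the
   image. *)
- apply: contraNeq; rewrite cards_eq0 => /set0Pn[x]; rewrite inE D2 addrC.
  rewrite addr_eq0 => /eqP ->; apply/memv_imgP; exists (- x); first exact: memvf.
  exact/esym/(linearN L).
Qed.
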